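(* Let $K$ be a field, let $u$ be a squarefree monomial in $S=K[x_1,\ldots,x_n]$ and let $I=B_1(u)$ be the squarefree principal Borel ideal with Borel generator $u$. Then the multiplicity $e(S/\operatorname{HS}_k(I))$ is a unimodal function of $k$ ($k=0,1,2,\ldots$).
   Context: $\operatorname{supp}(u)=\{i:x_i\mid u\}$. A squarefree monomial ideal $I$ (one generated by squarefree monomials) is a squarefree Borel ideal (also called $1$-Borel) if for every squarefree monomial $u\in I$, every $j\in\operatorname{supp}(u)$ and every $i<j$ one has $x_i(u/x_j)\in I$, provided $x_i(u/x_j)$ is squarefree. $B_1(u)$ is the smallest squarefree Borel ideal containing $u$. For a monomial ideal $I\subset S$ with minimal $\mathbb Z^n$-graded free resolution $\mathbb F\to I$, $F_i=\bigoplus_{j=1}^{b_i}S(-\mathbf a_{ij})$, the $i$th homological shift ideal is $\operatorname{HS}_i(I)=(\mathbf x^{\mathbf a_{ij}}: j=1,\ldots,b_i)$; so $\operatorname{HS}_0(I)=I$, and $\operatorname{HS}_i(I)=0$ if $F_i=0$. A function $f$ of $k$ is unimodal if there is $p$ such that $f(k)\le f(k+1)$ for $k<p$ and $f(k)\ge f(k+1)$ for $k\ge p$. $e(S/J)$ is the multiplicity of the standard graded algebra $S/J$. *)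

(* Defs.v *)
From HB Require Import structures.
From mathcomp Require Import all_boot all_order all_algebra.
From mathcomp Require Export mpoly.
From Stdlib Require Import ClassicalEpsilon.

Set Implicit Arguments.
Unset Strict Implicit.
Unset Printing Implicit Defensive.

Import Order.TTheory GRing.Theory Num.Theory.
Local Open Scope ring_scope.

(* Ideals of S = K[x_1, ..., x_n] are predicates on {mpoly K[n]}; the variable
   x_(i+1) is 'X_i for i : 'I_n, and a monomial is represented by its exponent
   vector in 'X_{1..n}. *)

Section Ideals.
Variables (K : fieldType) (n : nat).
Implicit Types (m u : 'X_{1..n}) (J : {mpoly K[n]} -> Prop).

Definition monomial_ideal (G : 'X_{1..n} -> Prop) : {mpoly K[n]} -> Prop :=
  fun f => exists r : seq ({mpoly K[n]} * 'X_{1..n}),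
    (forall c, c \in r -> G c.2) /\ f = \sum_(c <- r) c.1 * 'X_[c.2].

Definition squarefree m : Prop := forall i : 'I_n, (m i <= 1)%N.

Definition squarefree_monomial_ideal J : Prop :=
  exists G : 'X_{1..n} -> Prop,
    (forall m, G m -> squarefree m) /\
    (forall f, J f <-> monomial_ideal G f).

Definition squarefree_Borel J : Prop :=
  squarefree_monomial_ideal J /\
  forall u, squarefree u -> J 'X_[u] ->
  forall i j : 'I_n, (0 < u j)%N -> (i < j)%N ->
  squarefree (u - U_(j) + U_(i))%MM ->
  J 'X_[(u - U_(j) + U_(i))%MM].

(* See B1_Borel, mem_B1 and B1_smallest below. *)
Definition B1 u : {mpoly K[n]} -> Prop :=
  fun f => forall J, squarefree_Borel J -> J 'X_[u] -> J f.

End Ideals.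

Section Resolutions.
Variables (K : fieldType) (n : nat).

(* The data of ... -> F_1 -> F_0 -> S with F_i = \bigoplus_j S(- shift i j).
   Elements of F_i are row vectors, and the maps act by right multiplication. *)
Record free_complex := FreeComplex {
  frank : nat -> nat;
  shift : forall i, 'I_(frank i) -> 'X_{1..n};
  diff : forall i, 'M[{mpoly K[n]}]_(frank i.+1, frank i);
  augm : 'cV[{mpoly K[n]}]_(frank 0)
}.

Record minimal_free_resolution (F : free_complex) (I : {mpoly K[n]} -> Prop) :
    Prop := MinimalFreeResolution {
  (* the maps preserve the Z^n-degree *)
  augm_graded : forall (j : 'I_(frank F 0)) m,
    m \in msupp (augm F j 0) -> m = shift j;
  diff_graded : forall i (j : 'I_(frank F i.+1)) (k : 'I_(frank F i)) m,
    m \in msupp (diff F i j k) -> (m + shift k)%MM = shift j;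
  augm_image : forall f,
    I f <-> exists v : 'rV_(frank F 0), f = (v *m augm F) 0 0;
  augm_exact : forall v : 'rV_(frank F 0),
    v *m augm F = 0 <-> exists w, v = w *m diff F 0;
  diff_exact : forall i (v : 'rV_(frank F i.+1)),
    v *m diff F i = 0 <-> exists w, v = w *m diff F i.+1;
  (* minimality: the entries of the differentials lie in (x_1, ..., x_n) *)
  diff_minimal : forall i (j : 'I_(frank F i.+1)) (k : 'I_(frank F i)),
    (diff F i j k)@_0%MM = 0
}.

Definition HS (F : free_complex) (i : nat) : {mpoly K[n]} -> Prop :=
  monomial_ideal (fun a => exists j : 'I_(frank F i), a = shift j).

End Resolutions.

Section Multiplicity.
Variables (K : fieldType) (n : nat).
Implicit Type J : {mpoly K[n]} -> Prop.

(* dim_K (S/J)_d = h: some h forms of degree d induce a K-basis of (S/J)_d. *)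
Definition hilbert_value J (d h : nat) : Prop :=
  exists b : 'I_h -> {mpoly K[n]},
    (forall i, b i \is d.-homog) /\
    forall p : {mpoly K[n]}, p \is d.-homog ->
      exists! c : {ffun 'I_h -> K}, J (p - \sum_i c i *: b i).

(* With P the Hilbert polynomial of S/J: if dim S/J = D > 0 then deg P = D - 1
   and e = (D - 1)! * lead_coef P; if P = 0 then e is the length of S/J. *)
Definition is_multiplicity J (e : rat) : Prop :=
  exists (H : nat -> nat) (P : {poly rat}) (N : nat),
    [/\ forall d, hilbert_value J d (H d),
        forall d, (N <= d)%N -> (H d)%:R = P.[d%:R]
      & e = if P == 0 then (\sum_(d < N) H d)%:R
            else ((size P).-1)`!%:R * lead_coef P].

Definition multiplicity J : rat := epsilon (inhabits 0) (is_multiplicity J).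

End Multiplicity.

Definition unimodal (f : nat -> rat) : Prop :=
  exists p : nat, (forall k, (k < p)%N -> f k <= f k.+1) /\
                  (forall k, (p <= k)%N -> f k.+1 <= f k).

Section B1Smallest.
Variables (K : fieldType) (n : nat) (u : 'X_{1..n}).

Lemma mem_B1 : @B1 K n u 'X_[u].
Proof. by move=> J. Qed.

Lemma B1_smallest (J : {mpoly K[n]} -> Prop) :
  squarefree_Borel J -> J 'X_[u] -> forall f, B1 u f -> J f.
Proof. by move=> hJ Ju f; apply. Qed.

Let rad (m : 'X_{1..n}) : 'X_{1..n} := [multinom minn (m i) 1 | i < n].

Lemma mem_monomial_ideal (G : 'X_{1..n} -> Prop) (g m : 'X_{1..n}) :
  G g -> (g <= m)%MM -> @monomial_ideal K n G 'X_[m].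
Proof.
move=> Gg gm; exists [:: ('X_[(m - g)%MM], g)]; split.
  by move=> c; rewrite inE => /eqP ->.
by rewrite big_seq1 -mpolyXD submK.
Qed.

Lemma monomial_ideal_supp (G : 'X_{1..n} -> Prop) (f : {mpoly K[n]}) m :
  monomial_ideal G f -> m \in msupp f -> exists2 g, G g & (g <= m)%MM.
Proof.
case=> r [rG ->]; elim: r rG => [|c r IH] rG; first by rewrite big_nil msupp0.
rewrite big_cons => /msuppD_le; rewrite mem_cat => /orP[|].
  move=> /msuppM_le /allpairsP[[a b] /= [_ bc ->]].
  exists c.2; first by apply: rG; rewrite mem_head.
  by move: bc; rewrite msuppX inE => /eqP ->; apply: lem_addl; apply: lemm_refl.
by apply: IH => d dr; apply: rG; rewrite inE dr orbT.
Qed.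

Lemma B1_Borel : squarefree_Borel (@B1 K n u).
Proof.
split; last first.
  move=> v sv Bv i j vj ij sw J hJ Ju; apply: hJ.2 => //; exact: Bv.
exists (fun m => squarefree m /\ B1 u ('X_[m] : {mpoly K[n]})); split.
  by move=> m [].
move=> f; split.
  move=> Bf; exists [seq (f@_m *: 'X_[(m - rad m)%MM], rad m) | m <- msupp f].
  split; last first.
    rewrite big_map {1}[f]mpolyE; apply: eq_bigr => m _ /=.
    rewrite -scalerAl -mpolyXD submK //.
    by apply/mnm_lepP => i; rewrite mnmE geq_minl.
  move=> _ /mapP[m mf ->] /=; split; first by move=> i; rewrite mnmE geq_minr.
  move=> J hJ Ju; have [[G [Gs JE]] _] := hJ.
  have [g Gg gm] := monomial_ideal_supp ((JE f).1 (Bf J hJ Ju)) mf.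
  apply/JE; apply: (mem_monomial_ideal Gg); apply/mnm_lepP => i.
  by rewrite mnmE leq_min (mnm_lepP gm) (Gs _ Gg).
case=> r [rB ->] J hJ Ju; have [[G [Gs JE]] _] := hJ.
apply/JE; elim: r rB => [|c r IH] rB.
  by rewrite big_nil; exists [::]; rewrite big_nil.
have [|s [sG sE]] := IH; first by move=> d dr; apply: rB; rewrite inE dr orbT.
have [_ /(_ J hJ Ju)/JE[t [tG tE]]] := rB c (mem_head _ _).
exists ([seq (c.1 * d.1, d.2) | d <- t] ++ s); split.
  by move=> d; rewrite mem_cat => /orP[/mapP[d' /tG ? ->]|/sG].
rewrite big_cons big_cat /= sE tE; congr (_ + _).
by rewrite big_map mulr_sumr; apply: eq_bigr => d _; rewrite mulrA.
Qed.

End B1Smallest.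

(* Main.v *)
Require Import Defs.
From mathcomp Require Import all_boot all_order all_algebra.
From mathcomp Require Import zify.
From Stdlib Require Import ClassicalEpsilon.

Set Implicit Arguments.
Unset Strict Implicit.
Unset Printing Implicit Defensive.

Import Order.TTheory GRing.Theory Num.Theory.
Local Open Scope ring_scope.

(** Let [I = B1 u]. Write [a] for the support of [u], [d] for its size and
    [M] for one plus its largest index, so that in one-based notation [M] is
    the largest index occurring in [u]. For a set [s] of variables let [cnt
    s t] be the number of indices of [s] below [t]. The proof determines
    every [HS_k] and then its multiplicity.

    Membership in [B1 u] is a counting condition: a monomial lies in [B1 u]
    iff [cnt a t <= cnt s t] for all [t], where [s] is its support ([B1E]).

    [HS_k] is the squarefree ideal of the monomials whose support [s]
    satisfies [d + k <= cnt s M] and [cnt a t <= cnt s t] for all [t < M]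
    ([HS_HSsupp]). That every shift is of this kind follows from minimality
    alone: each step of the resolution raises the degree, and a shift cannot
    involve a variable [x_v] with an exponent at which the monomials of [I]
    remain in [I] after division by [x_v] ([shift_cap]), as the
    corresponding row of the differential would be [x_v] times a cycle.
    Conversely, for [d > 0], let [w] be the product of the first [d - 1]
    variables of [s] and [G] a set of [k + 1] further variables of [s] below
    [M]. All [w * x_t], with [t] in [G], lie in [I], and [w] does not. The
    Koszul relations on [G] lift step by step along the resolution; the
    lifts are non-zero and, the shifts of level [i] having degree at least
    [d + i], they only involve basis elements of degree exactly theirs. So
    [w] times the product of [G] is a shift of level [k] ([shift_exists]).
    No explicit resolution is needed.

    The multiplicity of the quotient by a squarefree monomial ideal is the
    number of vertex covers of minimal size, that is, of the largest faces
    of the Stanley-Reisner complex ([multiplicity_covers]), because ['C(e -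
    1, #|s| - 1)] monomials of degree [e > 0] have a given non-empty face
    [s] as support.

    Let [j] be the one-based first index of [u] and [h = M + 1 - (d + k)],
    truncated at zero. If [h <= j], the smallest covers are the subsets of
    size [h] of the first [M] variables, and the multiplicity is ['C(M, h)]
    ([multiplicity_HS_small]). If [h > j], the smallest covers have size [j]
    and do not depend on [k]; their number [c] is at most ['C(M, j)]
    ([multiplicity_HS_large], [earlycovers_le]). As [k] grows, the
    multiplicity is therefore constantly [c] and then runs through ['C(M,
    h)] for decreasing [h <= j] down to ['C(M, 0) = 1]; this is unimodal.
    For [u = 1] the values are 0, 1, 1, and so on. *)

(** * Multiplicities of squarefree monomial ideals *)

(** The support of a monomial, as a set of variables. *)
Definition msupport n (m : 'X_{1..n}) : {set 'I_n} := [set i | (0 < m i)%N].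

Lemma in_msupport n (m : 'X_{1..n}) i : (i \in msupport m) = (0 < m i)%N.
Proof. by rewrite inE. Qed.

Lemma card_msupport_le n (m : 'X_{1..n}) : (#|msupport m| <= mdeg m)%N.
Proof.
rewrite -sum1_card mdegE big_mkcond /=; apply: leq_sum => i _.
by rewrite in_msupport; case: (m i).
Qed.

Lemma msupport_eq0 n (m : 'X_{1..n}) : (msupport m == set0) = (mdeg m == 0%N).
Proof.
rewrite mdeg_eq0; apply/eqP/eqP => [s0|->]; last first.
  by apply/setP => i; rewrite in_msupport mnm0E inE.
apply/mnmP => i; rewrite mnm0E; apply/eqP; rewrite -leqn0 leqNgt.
by rewrite -in_msupport s0 inE.
Qed.

(** The monomials of degree [d] with support exactly [s] correspond to the
    compositions of [d] into [#|s|] positive parts. *)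
Lemma card_mnm_msupport n (s : {set 'I_n}) d : (0 < d)%N -> s != set0 ->
  #|[set m : 'X_{1..n < d.+1} | (mdeg m == d) && (msupport m == s)]|
    = 'C(d.-1, #|s|.-1).
Proof.
move=> d_gt0 s_n0; have : (0 < #|s|)%N by rewrite card_gt0.
case cs: #|s| => [//|k] _ /=; set A := [set _ | _].
have [ltds|leds] := ltnP d k.+1.
  rewrite bin_small; last by lia.
  apply/eqP; rewrite cards_eq0; apply/eqP/setP => m; rewrite !inE.
  apply/negP => /andP[/eqP md /eqP ms].
  by have := card_msupport_le m; rewrite md ms cs leqNgt ltds.
have [i0 _] := set0Pn _ s_n0.
pose e := nth i0 (enum s).
have e_in j : (j < k.+1)%N -> e j \in s.
  by move=> jk; rewrite -mem_enum mem_nth // -cardE cs.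
pose f (m : 'X_{1..n < d.+1}) : k.+1.-tuple 'I_(d - k.+1).+1 :=
  [tuple inord (m (e j)).-1 | j < k.+1].
(* The degree of m is the sum of its exponents along its support. *)
have degs (m : 'X_{1..n}) : msupport m = s ->
    mdeg m = (\sum_(j < k.+1) (m (e j)).-1 + k.+1)%N.
  move=> ms; have mpos j : j \in s -> (0 < m j)%N by rewrite -ms in_msupport.
  rewrite mdegE (bigID (mem s)) /= [X in (_ + X)%N]big1 ?addn0; last first.
    by move=> i; rewrite -ms in_msupport -eqn0Ngt => /eqP.
  rewrite -big_enum /= (big_nth i0) -cardE cs big_mkord.
  transitivity (\sum_(j < k.+1) ((m (e j)).-1 + 1))%N; last first.
    by rewrite big_split /= sum1_card card_ord.
  by apply: eq_bigr => j _; rewrite addn1 prednK // mpos // e_in.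
have small (m : 'X_{1..n < d.+1}) j : m \in A ->
    (j < k.+1)%N -> ((m (e j)).-1 < (d - k.+1).+1)%N.
  rewrite inE => /andP[/eqP md /eqP /degs dE] jk.
  have : ((m (e j)).-1 <= \sum_(i < k.+1) (m (e i)).-1)%N.
    by rewrite (bigD1 (Ordinal jk)) //= leq_addr.
  lia.
have fE (m : 'X_{1..n < d.+1}) (j : 'I_k.+1) : m \in A ->
    tnth (f m) j = (m (e j)).-1 :> nat.
  by move=> mA; rewrite tnth_mktuple inordK // small.
have f_inj : {in A &, injective f}.
  move=> m m' mA m'A ff; apply/val_inj/mnmP => i /=.
  move: (mA) (m'A); rewrite !inE => /andP[_ /eqP ms] /andP[_ /eqP ms'].
  have [is_|] := boolP (i \in s); last first.
    move=> iNs; move: (iNs); rewrite -{1}ms in_msupport -eqn0Ngt => /eqP ->.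
    by move: iNs; rewrite -ms' in_msupport -eqn0Ngt => /eqP ->.
  have jk : (index i (enum s) < k.+1)%N by rewrite -cs cardE index_mem mem_enum.
  have ei : e (Ordinal jk) = i by rewrite /e nth_index // mem_enum.
  have := fE m (Ordinal jk) mA; rewrite ff fE // ei.
  move: is_; rewrite -{1}ms in_msupport => m0.
  have : (0 < m' i)%N by rewrite -in_msupport ms' -ms in_msupport.
  by lia.
rewrite -(card_in_imset f_inj).
rewrite (_ : 'C(d.-1, k) = 'C(k + (d - k.+1), k)); last by congr 'C(_, _); lia.
rewrite -card_ord_partitions; congr #|pred_of_set _|; apply/setP => t.
apply/imsetP/idP => [[m mA ->]|]; rewrite inE.
  apply/eqP; rewrite big_tuple (eq_bigr (fun j : 'I__ => (m (e j)).-1)).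
    move: mA; rewrite inE => /andP[/eqP md /eqP /degs dE].
    by apply: (@addIn k.+1); rewrite -dE subnK // md.
  by move=> j _; rewrite fE.
rewrite big_tuple => /eqP st.
pose m0 : 'X_{1..n} := [multinom
  (if i \in s then (nth ord0 t (index i (enum s))).+1 else 0%N) | i < n].
have m0s : msupport m0 = s.
  by apply/setP => i; rewrite in_msupport mnmE; case: ifP.
have m0e (j : 'I_k.+1) : m0 (e j) = (tnth t j).+1.
  rewrite mnmE e_in // /e index_uniq ?enum_uniq -?cardE ?cs //.
  by rewrite (tnth_nth ord0).
have m0d : mdeg m0 = d.
  rewrite degs // (eq_bigr (fun j : 'I__ => tnth t j : nat)) ?st ?subnK //.
  by move=> j _; rewrite m0e.
have m0b : (mdeg m0 < d.+1)%N by rewrite m0d.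
have mA : BMultinom m0b \in A by rewrite inE /= m0d m0s !eqxx.
exists (BMultinom m0b) => //.
by apply: eq_from_tnth => j; apply/val_inj; rewrite /= fE //= m0e.
Qed.

(** [J] is spanned by the monomials whose support satisfies [Q].  The faces are
    the sets that do not satisfy [Q]; [Q] is not required to be upward closed. *)
Section SupportIdeal.
Variables (K : fieldType) (n : nat) (J : {mpoly K[n]} -> Prop).
Variable Q : pred {set 'I_n}.
Hypothesis J_Q : forall f, J f <-> forall m, m \in msupp f -> Q (msupport m).

(** The monomials of degree [d] outside [J]: they induce a basis of the
    degree [d] part of the quotient by [J]. *)
Definition standard d : {set 'X_{1..n < d.+1}} :=
  [set m : 'X_{1..n < d.+1} | (mdeg m == d) && ~~ Q (msupport m)].

(** Enumeration of the standard monomials of degree [d]. *)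
Definition stdmon d (i : 'I_#|standard d|) : 'X_{1..n} := bmnm (enum_val i).

Lemma mdeg_stdmon d (i : 'I_#|standard d|) : mdeg (stdmon i) = d.
Proof. by have := enum_valP i; rewrite inE => /andP[/eqP]. Qed.

Lemma stdmonNQ d (i : 'I_#|standard d|) : ~~ Q (msupport (stdmon i)).
Proof. by have := enum_valP i; rewrite inE => /andP[]. Qed.

Lemma stdmon_inj d : injective (@stdmon d).
Proof. by move=> i j ij; apply/enum_val_inj/val_inj. Qed.

Lemma standard_homog (d : nat) (f : {mpoly K[n]}) : f \is d.-homog ->
  J f <-> forall j : 'I_#|standard d|, f@_(stdmon j) = 0.
Proof.
move=> hf; split=> [/J_Q Jf j|f0].
  apply/memN_msupp_eq0/negP => /Jf Qj.
  by move: (stdmonNQ j); rewrite Qj.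
apply/J_Q => m mf; apply: contraT => NQ.
have md : mdeg m = d := dhomog_mf hf mf.
have mb : (mdeg m < d.+1)%N by rewrite md.
have mS : BMultinom mb \in standard d by rewrite inE /= md eqxx.
have := f0 (enum_rank_in mS (BMultinom mb)).
have -> : stdmon (enum_rank_in mS (BMultinom mb)) = m.
  exact: (congr1 _ (enum_rankK_in mS mS)).
by move=> /eqP; rewrite mcoeff_eq0 mf.
Qed.

Lemma coef_sumXstd d (c : 'I_#|standard d| -> K) (j : 'I_#|standard d|) :
  (\sum_i c i *: 'X_[stdmon i])@_(stdmon j) = c j.
Proof.
rewrite raddf_sum (bigD1 j) //= mcoeffZ mcoeffX eqxx mulr1 big1 ?addr0 //.
move=> i ij; rewrite mcoeffZ mcoeffX.
case: eqP => [eij|]; last by rewrite mulr0.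
by case/eqP: ij; apply: stdmon_inj.
Qed.

(** For the uniqueness of the Hilbert value, the matrix of the coefficients of
    the chosen forms at the standard monomials is row free and row full, hence
    square. *)
Lemma hilbert_valueP d h : hilbert_value J d h <-> h = #|standard d|.
Proof.
pose sumX (c : 'I_#|standard d| -> K) :=
  \sum_i c i *: 'X_[stdmon i].
have sumXh c : sumX c \is d.-homog.
  by apply: rpred_sum => i _; apply: rpredZ; rewrite dhomogX /= mdeg_stdmon.
split=> [[b [bh bP]]|->]; last first.
  exists (fun i => 'X_[stdmon i]); split.
    by move=> i; rewrite dhomogX /= mdeg_stdmon.
  move=> p hp; exists [ffun i => p@_(stdmon i)]; split=> [|c].
    apply/standard_homog => [|j]; first exact: (rpredB hp (sumXh _)).
    by rewrite mcoeffB coef_sumXstd ffunE subrr.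
  move/standard_homog => c0; apply/ffunP => i; rewrite ffunE.
  have /c0/(_ i) : p - sumX c \is d.-homog by exact: (rpredB hp (sumXh c)).
  by rewrite mcoeffB coef_sumXstd => /eqP; rewrite subr_eq0 => /eqP.
pose B : 'M[K]_(h, #|standard d|) := \matrix_(i, j) (b i)@_(stdmon j).
have sumbh (c : {ffun 'I_h -> K}) : \sum_i c i *: b i \is d.-homog.
  by apply: rpred_sum => i _; apply: rpredZ.
have BP (r : 'rV_#|standard d|) (c : {ffun 'I_h -> K}) :
    J (sumX (fun j => r 0 j) - \sum_i c i *: b i) <->
    r = (\row_i c i) *m B.
  have hh : sumX (fun j => r 0 j) - \sum_i c i *: b i \is d.-homog.
    exact: (rpredB (sumXh _) (sumbh c)).
  have bE j : (\sum_i c i *: b i)@_(stdmon j) = ((\row_i c i) *m B) 0 j.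
    rewrite raddf_sum mxE; apply: eq_bigr => i _.
    by rewrite !mxE -mcoeffZ.
  split=> [/(standard_homog hh) r0|rE].
    apply/rowP => j; have /eqP := r0 j.
    by rewrite mcoeffB coef_sumXstd bE subr_eq0 => /eqP.
  apply/(standard_homog hh) => j.
  by rewrite mcoeffB coef_sumXstd bE -rE subrr.
have Bfull : row_full B.
  rewrite -sub1mx; apply/row_subP => i.
  have [c [/BP rE _]] := bP _ (sumXh (fun j => (row i 1%:M : 'rV_#|standard d|) 0 j)).
  by rewrite rE submxMl.
have Bfree : row_free B.
  rewrite -kermx_eq0; apply/rowV0P => v /sub_kermxP vB.
  have [c [_ cU]] := bP _ (sumXh (fun j => (0 : 'rV[K]_#|standard d|) 0 j)).
  have c0 : c = [ffun=> 0].
    apply: cU; apply/BP; rewrite (_ : \row__ _ = 0) ?mul0mx //.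
    by apply/rowP => i; rewrite !mxE ffunE.
  have cv : c = [ffun i => v 0 i].
    apply: cU; apply/BP; rewrite -[LHS]vB; congr (_ *m _).
    by apply/rowP => i; rewrite !mxE ffunE.
  apply/rowP => i; rewrite mxE.
  by have := congr1 (fun g : {ffun _ -> _} => g i) cv; rewrite c0 !ffunE.
by rewrite -(eqP Bfree : \rank B = h) (eqP Bfull : \rank B = _).
Qed.

Lemma eq_poly_from (N : nat) (p q : {poly rat}) :
  (forall d, (N <= d)%N -> p.[d%:R] = q.[d%:R]) -> p = q.
Proof.
move=> pq; apply/eqP; rewrite -subr_eq0; apply: contraT => nz.
pose rs := [seq i%:R : rat | i <- iota N (size (p - q))].
have : (size rs < size (p - q)%R)%N.
  apply: max_poly_roots => //.
    apply/allP => x /mapP[i]; rewrite mem_iota => /andP[Ni _] ->.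
    by apply/rootP; rewrite hornerD hornerN pq // subrr.
  rewrite map_inj_uniq ?iota_uniq // => i j /eqP.
  by rewrite eqr_nat => /eqP.
by rewrite size_map size_iota ltnn.
Qed.

Lemma is_multiplicity_inj e e' :
  is_multiplicity J e -> is_multiplicity J e' -> e = e'.
Proof.
move=> [H [P [N [HH HP ->]]]] [H' [P' [N' [HH' HP' ->]]]].
have HE d : H d = H' d.
  by have /hilbert_valueP -> := HH d; have /hilbert_valueP -> := HH' d.
have PE : P = P'.
  apply: (@eq_poly_from (maxn N N')) => d; rewrite geq_max => /andP[Nd Nd'].
  by rewrite -HP // HE HP'.
rewrite -PE in HP' *; case: eqP => // P0; congr (_%:R).
wlog NN : N N' H H' HH HH' HP HP' HE / (N <= N')%N.
  move=> W; have [NN|/ltnW NN] := leqP N N'; first exact: (W N N' H H').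
  apply/esym; exact: (W N' N H' H).
rewrite -!(big_mkord xpredT) (big_cat_nat _ NN) //=.
rewrite [X in (_ + X)%N]big_nat_cond [X in (_ + X)%N]big1 ?addn0.
  by apply: eq_bigr.
move=> i; rewrite andbT => /andP[Ni _]; rewrite -HE; apply/eqP.
by rewrite -(eqr_nat rat) HP // P0 horner0.
Qed.

Lemma multiplicityE e : is_multiplicity J e -> multiplicity J = e.
Proof.
move=> eP; refine (is_multiplicity_inj _ eP).
by apply: epsilon_spec; exists e.
Qed.

Lemma card_standard d : #|standard d| =
  (\sum_(s | ~~ Q s)
     #|[set m : 'X_{1..n < d.+1} | (mdeg m == d) && (msupport m == s)]|)%N.
Proof.
rewrite -sum1_card.
rewrite (partition_big (fun m : 'X_{1..n < d.+1} => msupport m)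
          (fun s => ~~ Q s)) /=; last by move=> m; rewrite inE => /andP[].
apply: eq_bigr => s Qs; rewrite -sum1_card; apply: eq_bigl => m.
rewrite !inE -andbA; congr (_ && _); apply: andb_idl => /eqP -> //.
Qed.

(** The polynomial of degree [k] with value ['C(d - 1, k)] at every positive
    integer [d]. *)
Definition binpoly k : {poly rat} :=
  k`!%:R^-1 *: \prod_(i < k) ('X - (i.+1%:R)%:P).

Lemma binpolyE k d : (0 < d)%N -> (binpoly k).[d%:R] = 'C(d.-1, k)%:R.
Proof.
case: d => // d _ /=; rewrite /binpoly hornerZ horner_prod.
have fN0 : k`!%:R != 0 :> rat by rewrite pnatr_eq0 -lt0n fact_gt0.
apply: (mulfI fN0); rewrite mulrA divff // mul1r -natrM mulnC bin_ffact.
rewrite ffact_prod natr_prod; have [kd|dk] := leqP k d.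
  apply: eq_bigr => i _; rewrite hornerXsubC -natrB ?subSS //.
  by have := ltn_ord i; lia.
(* For [d < k] both products contain the factor 0. *)
rewrite (bigD1 (Ordinal dk)) // [RHS](bigD1 (Ordinal dk)) //= hornerXsubC.
by rewrite !subrr subnn !mul0r.
Qed.

Lemma size_binpoly k : size (binpoly k) = k.+1.
Proof.
rewrite size_scale ?invr_eq0 ?pnatr_eq0 -?lt0n ?fact_gt0 //.
by rewrite size_prod_XsubC /index_enum -enumT size_enum_ord.
Qed.

Lemma lead_binpoly k : (binpoly k)`_k = k`!%:R^-1.
Proof.
have := monic_prod_XsubC (index_enum 'I_k) xpredT (fun i : 'I_k => i.+1%:R : rat).
rewrite monicE /lead_coef size_prod_XsubC /index_enum -enumT size_enum_ord /=.
by move=> /eqP; rewrite coefZ enumT => ->; rewrite mulr1.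
Qed.

Lemma multiplicity_void : (forall s, Q s) -> multiplicity J = 0.
Proof.
move=> Qall; apply: multiplicityE.
have H0 d : #|standard d| = 0%N.
  by rewrite card_standard big1 // => s; rewrite Qall.
exists (fun d => #|standard d|), 0, 0%N; split.
- by move=> d; apply/hilbert_valueP.
- by move=> d _; rewrite horner0 H0.
by rewrite eqxx big_ord0.
Qed.

(** If the largest faces have size [D], the multiplicity is their number.  For
    [D = 0] the only face is empty and the quotient has length one. *)
Lemma multiplicity_faces D : (forall s, ~~ Q s -> (#|s| <= D)%N) ->
  (exists2 s, ~~ Q s & #|s| = D) ->
  multiplicity J = #|[set s | ~~ Q s & #|s| == D]|%:R.
Proof.
move=> Dmax [s0 Qs0 cs0]; apply: multiplicityE.
have HH d : hilbert_value J d #|standard d| by apply/hilbert_valueP.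
case: D => [|D] in Dmax cs0 *.
  have Q0 s : ~~ Q s = (s == set0).
    apply/idP/eqP => [/Dmax|->]; first by rewrite leqn0 cards_eq0 => /eqP.
    by move/eqP: cs0; rewrite cards_eq0 => /eqP <-.
  exists (fun d => #|standard d|), 0, 1%N; split => // [d d0|].
    rewrite horner0 card_standard (eq_bigl _ _ Q0) big_pred1_eq.
    apply/eqP; rewrite pnatr_eq0 cards_eq0; apply/eqP/setP => m.
    rewrite !inE; apply/negP => /andP[/eqP md].
    by rewrite msupport_eq0 md; move: d0; case: d {m md}.
  rewrite eqxx big_ord_recl big_ord0 addn0; congr (_%:R).
  have -> : [set s | ~~ Q s & #|s| == 0%N] = [set set0].
    by apply/setP => s; rewrite !inE Q0 cards_eq0 andbb.
  rewrite cards1 /=; apply/esym/eqP/cards1P.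
  have b0 : (mdeg (0%MM : 'X_{1..n}) < 1)%N by rewrite mdeg0.
  exists (BMultinom b0); apply/setP => m; rewrite !inE Q0 msupport_eq0 andbb.
  by rewrite mdeg_eq0.
(* The empty face has no monomials of positive degree. *)
pose P := \sum_(s | ~~ Q s && (s != set0)) binpoly #|s|.-1.
have coefD : P`_D = #|[set s | ~~ Q s & #|s| == D.+1]|%:R / D`!%:R.
  rewrite coef_sum (bigID (fun s : {set 'I_n} => #|s| == D.+1)) /=.
  rewrite [X in _ + X]big1 ?addr0; last first.
    move=> s /andP[/andP[/Dmax sD s0N] sND]; rewrite nth_default // size_binpoly.
    by move: s0N sD sND; rewrite -card_gt0; case: #|s| => [|c] //=; lia.
  rewrite -sum1_card natr_sum mulr_suml; apply: eq_big => s.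
    rewrite inE; case: (#|s| =P D.+1) => [cs|]; rewrite ?andbF // !andbT.
    by rewrite -card_gt0 cs /= andbT.
  by move=> /andP[_ /eqP ->]; rewrite lead_binpoly mul1r.
have cN0 : #|[set s | ~~ Q s & #|s| == D.+1]|%:R != 0 :> rat.
  by rewrite pnatr_eq0 cards_eq0; apply/set0Pn; exists s0; rewrite inE Qs0 cs0 /=.
have fN0 : D`!%:R != 0 :> rat by rewrite pnatr_eq0 -lt0n fact_gt0.
have PDN0 : P`_D != 0 by rewrite coefD mulf_neq0 ?invr_eq0.
have szP : size P = D.+1.
  apply/eqP; rewrite eqn_leq; apply/andP; split.
    apply: leq_trans (size_sum _ _ _) _; apply/bigmax_leqP => s /andP[/Dmax sD].
    by rewrite size_binpoly -card_gt0; case: #|s| sD => [|c] //=; lia.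
  by rewrite ltnNge; apply: contra PDN0 => /(nth_default 0) ->.
exists (fun d => #|standard d|), P, 1%N; split => // [d d0|].
  rewrite card_standard natr_sum horner_sum (bigID (fun s => s == set0)) /=.
  rewrite big1 ?add0r.
    by apply: eq_bigr => s /andP[_ s0N]; rewrite card_mnm_msupport // binpolyE.
  move=> s /andP[_ /eqP ->]; apply/eqP; rewrite pnatr_eq0 cards_eq0.
  apply/eqP/setP => m; rewrite !inE msupport_eq0.
  by apply/negP => /andP[/eqP ->]; case: d d0 {m}.
rewrite ifN; last by rewrite -size_poly_eq0 szP.
by rewrite /lead_coef szP /= coefD mulrC divfK.
Qed.

End SupportIdeal.

(** * Principal squarefree Borel ideals *)

Section MonomialIdeals.
Variables (K : fieldType) (n : nat).
Implicit Types (m : 'X_{1..n}) (f : {mpoly K[n]}).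

Lemma monomial_idealP (G : 'X_{1..n} -> Prop) f :
  monomial_ideal G f <->
  forall m, m \in msupp f -> exists2 g, G g & (g <= m)%MM.
Proof.
split=> [Gf m mf|Gf]; first exact: (monomial_ideal_supp Gf mf).
pose g m := epsilon (inhabits m) (fun g => G g /\ (g <= m)%MM).
have gP m : m \in msupp f -> G (g m) /\ (g m <= m)%MM.
  move=> /Gf[g0 Gg0 g0m].
  by apply: (epsilon_spec (inhabits m) (fun g => G g /\ (g <= m)%MM)); exists g0.
exists [seq (f@_m *: 'X_[(m - g m)%MM], g m) | m <- msupp f]; split.
  by move=> _ /mapP[m /gP[Gg _] ->].
rewrite big_map {1}[f]mpolyE; apply: eq_big_seq => m /gP[_ gm] /=.
by rewrite -scalerAl -mpolyXD submK.
Qed.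

Lemma squarefree_monomial_idealP (J : {mpoly K[n]} -> Prop) f :
  squarefree_monomial_ideal J ->
  J f <-> forall m, m \in msupp f -> J 'X_[m].
Proof.
move=> [G [_ JG]]; split=> [/JG/monomial_idealP Gf m /Gf[g Gg gm]|Jf].
  apply/JG/monomial_idealP => m'; rewrite msuppX inE => /eqP ->; by exists g.
apply/JG/monomial_idealP => m /Jf/JG/monomial_idealP; apply.
by rewrite msuppX inE.
Qed.

Lemma squarefree_monomial_ideal_dvd (J : {mpoly K[n]} -> Prop) m m' :
  squarefree_monomial_ideal J -> (m <= m')%MM -> J 'X_[m] -> J 'X_[m'].
Proof.
move=> [G [_ JG]] mm' /JG/monomial_idealP/(_ m).
rewrite msuppX inE eqxx => /(_ isT)[g Gg gm].
apply/JG/monomial_idealP => m1; rewrite msuppX inE => /eqP ->.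
by exists g => //; apply: lepm_trans mm'.
Qed.

End MonomialIdeals.

(** The squarefree monomial with support [A]. *)
Definition mnmset n (A : {set 'I_n}) : 'X_{1..n} := [multinom (i \in A : nat) | i < n].

Lemma mnmsetE n (A : {set 'I_n}) i : mnmset A i = (i \in A).
Proof. by rewrite mnmE. Qed.

Lemma msupport_mnmset n (A : {set 'I_n}) : msupport (mnmset A) = A.
Proof. by apply/setP => i; rewrite in_msupport mnmsetE lt0b. Qed.

Lemma squarefree_mnmset n (A : {set 'I_n}) : squarefree (mnmset A).
Proof. by move=> i; rewrite mnmsetE leq_b1. Qed.

Lemma squarefreeE n (m : 'X_{1..n}) : squarefree m -> m = mnmset (msupport m).
Proof.
move=> sm; apply/mnmP => i; rewrite mnmsetE in_msupport.
by have := sm i; case: (m i) => [|[|]].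
Qed.

Lemma mnmset_le n (A : {set 'I_n}) (m : 'X_{1..n}) :
  (mnmset A <= m)%MM = (A \subset msupport m).
Proof.
apply/mnm_lepP/subsetP => [Am i iA|Am i]; rewrite ?in_msupport.
  by have := Am i; rewrite mnmsetE iA.
by rewrite mnmsetE; have [/Am|//] := boolP (i \in A); rewrite in_msupport.
Qed.

Lemma mdeg_mnmset n (A : {set 'I_n}) : mdeg (mnmset A) = #|A|.
Proof.
rewrite mdegE -sum1_card [RHS]big_mkcond /=; apply: eq_bigr => i _.
by rewrite mnmsetE; case: (i \in A).
Qed.

(** The number of indices of [A] that are smaller than [t]. *)
Definition cnt n (A : {set 'I_n}) (t : nat) : nat := #|[set i in A | (i < t)%N]|.

Section Cnt.
Variable n : nat.
Implicit Types (A B : {set 'I_n}) (i j : 'I_n) (t : nat).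

Lemma cntS A B t : A \subset B -> (cnt A t <= cnt B t)%N.
Proof.
move=> /subsetP AB; apply: subset_leq_card; apply/subsetP => i.
by rewrite !inE => /andP[/AB -> ->].
Qed.

Lemma cntU1 A i t : i \notin A -> cnt (i |: A) t = ((i < t) + cnt A t)%N.
Proof.
move=> iA; rewrite /cnt; case: ltnP => it.
  rewrite (_ : [set j in i |: A | _] = i |: [set j in A | (j < t)%N]).
    by rewrite cardsU1 !inE (negbTE iA).
  by apply/setP => j; rewrite !inE; case: eqP => [->|].
rewrite add0n; congr #|pred_of_set _|; apply/setP => j; rewrite !inE.
by case: eqP => // ->; rewrite ltnNge it /= andbF.
Qed.

Lemma cntD1 A i t : i \in A -> cnt A t = ((i < t) + cnt (A :\ i) t)%N.
Proof. by move=> iA; rewrite -{1}(setD1K iA) cntU1 ?setD11. Qed.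

Lemma cnt_id A i : i \in A -> cnt A i.+1 = (cnt A i).+1.
Proof.
move=> iA; rewrite (cntD1 _ iA) ltnSn (cntD1 i iA) ltnn; congr _.+1.
congr #|pred_of_set _|; apply/setP => j; rewrite !inE ltnS leq_eqVlt.
by rewrite -val_eqE; case: eqP.
Qed.

Lemma cnt_notin A i : i \notin A -> cnt A i.+1 = cnt A i.
Proof.
move=> iA; congr #|pred_of_set _|; apply/setP => j; rewrite !inE ltnS leq_eqVlt.
by have [/val_inj ->|] := @eqP _ (j : nat) i; rewrite ?(negbTE iA).
Qed.

Lemma cnt_mono A t t' : (t <= t')%N -> (cnt A t <= cnt A t')%N.
Proof.
move=> tt'; apply: subset_leq_card; apply/subsetP => i; rewrite !inE.
by case/andP=> -> /leq_trans; apply.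
Qed.

Lemma cnt_le_card A t : (cnt A t <= #|A|)%N.
Proof. by apply: subset_leq_card; apply/subsetP => i; rewrite inE => /andP[]. Qed.

End Cnt.

(** [A] contains a subset of size [#|B|] whose [i]-th element is at most the
    [i]-th element of [B], for every [i]; expressed by counting. *)
Definition dominates n (A B : {set 'I_n}) : Prop := forall t, (cnt B t <= cnt A t)%N.

Section BorelMembership.
Variables (K : fieldType) (n : nat).
Implicit Types (A B : {set 'I_n}).

(** By induction on the size of [A :\: B]: a Borel move replaces the least [j] in
    [A :\: B] by some smaller [i] in [B :\: A], which exists since [B] dominates
    [A], and [B] still dominates the result. *)
Lemma squarefree_Borel_dominates (J : {mpoly K[n]} -> Prop) A B :
  squarefree_Borel J -> dominates B A -> J 'X_[mnmset A] -> J 'X_[mnmset B].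
Proof.
move=> [Jmon JB]; move: {2}#|A :\: B| (leqnn #|A :\: B|) => k.
elim: k => [|k IH] in A *; move=> ck dBA JA.
  apply: squarefree_monomial_ideal_dvd JA => //; rewrite mnmset_le msupport_mnmset.
  by rewrite -setD_eq0 -cards_eq0 -leqn0.
have [AB0|[j0 j0AB]] := set_0Vmem (A :\: B).
  by apply: IH => //; rewrite AB0 cards0.
have [j jAB jmin] := arg_minnP (fun j : 'I_n => j : nat) j0AB.
have {}jAB : j \in A :\: B by [].
have [jA jNB] : j \in A /\ j \notin B by move: jAB; rewrite !inE => /andP[].
have lowAB i : i \in A -> (i < j)%N -> i \in B.
  move=> iA ij; apply: contraT => iNB.
  have /jmin : i \in A :\: B by rewrite !inE iA iNB.
  by rewrite leqNgt ij.
have [i [iB ij iNA]] : exists i : 'I_n, [/\ i \in B, (i < j)%N & i \notin A].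
  have /subsetPn[i] : ~~ ([set i in B | (i < j)%N] \subset [set i in A | (i < j)%N]).
    apply/negP => /subset_leq_card; apply/negP; rewrite -ltnNge.
    by have := dBA j.+1; rewrite (cnt_id jA) (cnt_notin jNB).
  rewrite !inE => /andP[iB ij]; rewrite ij andbT => iNA; by exists i.
have iNj : i != j by apply: contraTneq ij => ->; rewrite ltnn.
pose A' := i |: (A :\ j).
have mA' : (mnmset A - U_(j) + U_(i))%MM = mnmset A'.
  apply/mnmP => l; rewrite mnmDE mnmBE !mnm1E !mnmsetE !inE.
  rewrite (eq_sym i l) (eq_sym j l).
  case: (l =P i) => [->|_]; first by rewrite (negbTE iNA).
  by case: (l =P j) => [->|_]; rewrite ?jA ?addn0 ?subn0.
have iNA' : i \notin A :\ j by rewrite !inE negb_and iNA orbT.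
apply: (IH A').
- rewrite -ltnS; apply: leq_trans ck; rewrite [leqRHS](cardsD1 j) jAB.
  rewrite ltnS; apply: subset_leq_card; apply/subsetP => l; rewrite !inE.
  by case: (l =P i) => [->|_] /=; rewrite ?iB // => /and3P[-> -> ->].
- move=> t; have [tj|jt] := leqP t j.
    apply: subset_leq_card; apply/subsetP => l; rewrite !inE => /andP[+ lt].
    rewrite lt andbT; case: (l =P i) => [-> //|_ /= /andP[_ lA]].
    by apply: lowAB => //; apply: leq_trans tj.
  rewrite cntU1 // (ltn_trans ij jt); have := dBA t.
  by rewrite (cntD1 t jA) jt.
rewrite -mA'; apply: JB => //; first exact: squarefree_mnmset.
  by rewrite mnmsetE jA.
by rewrite mA'; apply: squarefree_mnmset.
Qed.

Lemma B1E (u : 'X_{1..n}) (f : {mpoly K[n]}) : squarefree u ->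
  B1 u f <->
  forall m, m \in msupp f -> dominates (msupport m) (msupport u).
Proof.
move=> su; split=> [Bf|domf]; last first.
  move=> J JB Ju; apply/(squarefree_monomial_idealP _ JB.1) => m /domf dm.
  apply: (@squarefree_monomial_ideal_dvd _ _ _ (mnmset (msupport m))) => //.
  - exact: JB.1.
  - by rewrite mnmset_le.
  apply: squarefree_Borel_dominates dm _ => //.
  by rewrite -squarefreeE.
apply: (Bf (fun f => forall m, m \in msupp f ->
  dominates (msupport m) (msupport u))); last first.
  by move=> m; rewrite msuppX inE => /eqP -> t.
split.
  exists (fun m => squarefree m /\ dominates (msupport m) (msupport u)); split.
    by move=> m [].
  move=> g; rewrite monomial_idealP; split=> [dg m /dg dm|Gg m /Gg[h [sh dh] hm] t].
    exists (mnmset (msupport m)); last by rewrite mnmset_le.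
    by rewrite msupport_mnmset; split=> //; apply: squarefree_mnmset.
  apply: leq_trans (dh t) _; apply: cntS.
  by rewrite -mnmset_le -squarefreeE.
move=> v sv dv i j vj ij sw m; rewrite msuppX inE => /eqP -> t.
apply: leq_trans (dv v _ t) _; first by rewrite msuppX inE.
have iNj : (i == j) = false by apply/negP => /eqP eij; rewrite eij ltnn in ij.
have iNv : v i = 0%N.
  by have := sw i; rewrite mnmDE mnmBE !mnm1E eqxx eq_sym iNj subn0 addn1; case: (v i).
have jv : j \in msupport v by rewrite in_msupport.
have -> : msupport (v - U_(j) + U_(i))%MM = i |: (msupport v :\ j).
  apply/setP => l; rewrite !inE mnmDE mnmBE !mnm1E (eq_sym i l) (eq_sym j l).
  case: (l =P i) => [->|_]; first by rewrite addn1.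
  case: (l =P j) => [->|_]; last by rewrite subn0 addn0.
  by have := sv j; case: (v j) => [|[|]].
rewrite cntU1; last by rewrite !inE iNv andbF.
rewrite (cntD1 t jv) leq_add2r; case: (ltnP j t) => // jt.
by rewrite (ltn_trans ij jt).
Qed.

End BorelMembership.

(** * Shifts of minimal multigraded free resolutions *)

Section Koszul.
Variables (K : fieldType) (n : nat).

(** The Koszul boundary of a function on lists of variables: the alternating sum
    of ['X_t *: psi (s without t)] over the entries [t] of [s]. *)
Fixpoint koszul (V : lmodType {mpoly K[n]}) (s : seq 'I_n)
    (psi : seq 'I_n -> V) : V :=
  if s is t :: s' then 'X_t *: psi s' - koszul s' (fun x => psi (t :: x)) else 0.

Lemma koszul_ext (V : lmodType {mpoly K[n]}) s (psi psi' : seq 'I_n -> V) :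
  (forall s', subseq s' s -> (size s').+1 = size s -> psi s' = psi' s') ->
  koszul s psi = koszul s psi'.
Proof.
elim: s psi psi' => [//|t s IH] psi psi' E /=; rewrite (E s) ?subseq_cons //.
congr (_ - _); apply: IH => s' s's szs'.
by apply: E; rewrite /= ?eqxx // szs'.
Qed.

Lemma koszul_lin (V : lmodType {mpoly K[n]}) s a (psi psi' : seq 'I_n -> V) :
  koszul s (fun x => a *: psi x - psi' x) = a *: koszul s psi - koszul s psi'.
Proof.
elim: s psi psi' => [|t s IH] psi psi' /=; first by rewrite scaler0 subrr.
rewrite IH !scalerBr !scalerA (mulrC 'X_t a) !opprB -!addrA; congr (_ + _).
by rewrite addrCA [RHS]addrCA; congr (_ + _); rewrite addrC.
Qed.

Lemma koszul_mulmx r r' (A : 'M_(r, r')) s (psi : seq 'I_n -> 'rV[{mpoly K[n]}]_r) :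
  koszul s (fun x => psi x *m A) = koszul s psi *m A.
Proof.
elim: s psi => [|t s IH] psi /=; first by rewrite mul0mx.
by rewrite IH mulmxBl scalemxAl.
Qed.

Lemma koszul_koszul (V : lmodType {mpoly K[n]}) s (psi : seq 'I_n -> V) :
  koszul s (fun x => koszul x psi) = 0.
Proof.
elim: s psi => [|t s IH] psi //=.
by rewrite koszul_lin IH subr0 subrr.
Qed.

Lemma koszul_entry0 r s (psi : seq 'I_n -> 'rV[{mpoly K[n]}]_r) j :
  (forall s', subseq s' s -> (size s').+1 = size s -> psi s' 0 j = 0) ->
  koszul s psi 0 j = 0.
Proof.
elim: s psi => [|t s IH] psi psi0 /=; first by rewrite mxE.
rewrite !mxE psi0 ?subseq_cons // mulr0 add0r IH ?oppr0 // => s' s's szs'.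
by apply: psi0; rewrite /= ?eqxx // szs'.
Qed.

(** The vector [v] is homogeneous of multidegree [b], when the [j]-th basis
    element has multidegree [sh j]. *)
Definition homogeneous r (sh : 'I_r -> 'X_{1..n}) (b : 'X_{1..n})
    (v : 'rV[{mpoly K[n]}]_r) : Prop :=
  forall j m, m \in msupp (v 0 j) -> (m + sh j)%MM = b.

Lemma homogeneousB r (sh : 'I_r -> 'X_{1..n}) b v v' :
  homogeneous sh b v -> homogeneous sh b v' -> homogeneous sh b (v - v').
Proof.
move=> hv hv' j m; rewrite !mxE => /msuppB_le; rewrite mem_cat => /orP[/hv|/hv'] //.
Qed.

Lemma homogeneousX r (sh : 'I_r -> 'X_{1..n}) b v t :
  homogeneous sh b v -> homogeneous sh (b + U_(t)) ('X_t *: v).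
Proof.
move=> hv j m; rewrite mxE => /msuppM_le /allpairsP[[x y] /= [xs ys ->]].
move: xs; rewrite msuppX inE => /eqP ->.
by rewrite -addmA (hv _ _ ys) addmC.
Qed.

(** The exponent of the product of the variables listed in [s]. *)
Definition mnmseq (s : seq 'I_n) : 'X_{1..n} := (\sum_(t <- s) U_(t))%MM.

Lemma mnmseq_cons t s : mnmseq (t :: s) = (U_(t) + mnmseq s)%MM.
Proof. by rewrite /mnmseq big_cons. Qed.

Lemma mdeg_mnmseq s : mdeg (mnmseq s) = size s.
Proof.
elim: s => [|t s IH]; first by rewrite /mnmseq big_nil mdeg0.
by rewrite mnmseq_cons mdegD mdeg1 IH.
Qed.

Lemma mnmseq_notin t s : t \notin s -> mnmseq s t = 0%N.
Proof.
elim: s => [|t' s IH]; first by rewrite /mnmseq big_nil mnm0E.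
rewrite inE negb_or mnmseq_cons mnmDE mnm1E eq_sym => /andP[/negbTE -> /IH ->].
by [].
Qed.

Lemma homogeneous_koszul r (sh : 'I_r -> 'X_{1..n}) c s psi :
  (forall s', subseq s' s -> (size s').+1 = size s ->
     homogeneous sh (c + mnmseq s') (psi s')) ->
  homogeneous sh (c + mnmseq s) (koszul s psi).
Proof.
elim: s c psi => [|t s IH] c psi hpsi /=.
  by move=> j m; rewrite mxE msupp0.
apply: homogeneousB.
  rewrite mnmseq_cons (addmC U_(t)%MM) addmA; apply: homogeneousX.
  by apply: hpsi => //; apply: subseq_cons.
rewrite mnmseq_cons addmA; apply: IH => s' s's szs'.
rewrite -addmA -mnmseq_cons; apply: hpsi; rewrite /= ?eqxx // szs' //.
Qed.

Lemma mcoeffMXE (f : {mpoly K[n]}) e m :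
  (f * 'X_[e])@_m = if (e <= m)%MM then f@_(m - e)%MM else 0.
Proof.
case: ifP => [em|Nem]; first by rewrite -{1}(submK em) addmC mcoeffMX.
apply: memN_msupp_eq0; rewrite (perm_mem (msuppMX f e)).
by apply/negP => /mapP[m' _ mE]; rewrite mE lem_addr in Nem.
Qed.

(** A graded matrix entry has at most one term. *)
Lemma mono_poly (f : {mpoly K[n]}) x y :
  (forall m, m \in msupp f -> (m + x)%MM = y) -> f != 0 ->
  (x <= y)%MM /\ f = f@_(y - x)%MM *: 'X_[(y - x)%MM].
Proof.
move=> hf f0.
have sE m : m \in msupp f -> m = (y - x)%MM.
  by move=> /hf <-; rewrite addmK.
have /hf xy := mlead_supp f0.
split; first by rewrite -xy lem_addl.
apply/mpolyP => m; rewrite mcoeffZ mcoeffX.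
case: eqP => [<-|ne]; first by rewrite mulr1.
by rewrite mulr0; apply/memN_msupp_eq0/negP => /sE /esym.
Qed.

End Koszul.

Section Resolution.
Variables (K : fieldType) (n : nat) (F : free_complex K n).
Variable (I : {mpoly K[n]} -> Prop).
Hypothesis hF : minimal_free_resolution F I.

(** The ring itself is added below [F_0], at position [i] of [prank], [bd],
    [pshift] and [cycle] with [i = 0], so that the augmentation [bd 0] and the
    differentials [bd i.+1] are treated alike. *)
Definition prank i : nat := if i is i'.+1 then frank F i' else 1.

Definition bd i : 'M[{mpoly K[n]}]_(frank F i, prank i) :=
  match i with 0 => augm F | i'.+1 => diff F i' end.

Definition pshift i : 'I_(prank i) -> 'X_{1..n} :=
  match i with 0 => fun=> 0%MM | i'.+1 => fun k => shift k end.

(** The image of [bd i] is the set of the [z] with [cycle z]: the ideal for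
    [i = 0], and the kernel of [bd i.-1] otherwise. *)
Definition cycle i : 'rV[{mpoly K[n]}]_(prank i) -> Prop :=
  match i with 0 => fun z => I (z 0 0) | i'.+1 => fun z => z *m bd i' = 0 end.

Lemma cycleP i (z : 'rV_(prank i)) : cycle z <-> exists w, z = w *m bd i.
Proof.
case: i z => [|[|i]] z /=; last 2 first.
- exact: (augm_exact hF).
- exact: (diff_exact hF).
split=> [/(augm_image hF)[v zE]|[w ->]]; last by apply/(augm_image hF); exists w.
by exists v; apply/rowP => k; rewrite !(ord1 k).
Qed.

Lemma bd_graded i (j : 'I_(frank F i)) (k : 'I_(prank i)) m :
  m \in msupp (bd i j k) -> (m + pshift k)%MM = shift j.
Proof.
case: i j k => [|i] j k /=; last exact: (diff_graded hF).
by rewrite (ord1 k) addm0; apply: (augm_graded hF).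
Qed.

(** Minimality: a kernel vector has no constant terms. *)
Lemma ker_minimal i (v : 'rV_(frank F i)) j :
  v *m bd i = 0 -> (v 0 j)@_0%MM = 0.
Proof.
move=> /(@cycleP i.+1)[w ->]; rewrite mxE raddf_sum big1 //= => k _.
rewrite (mcoeff0_is_multiplicative n K).1; by rewrite (diff_minimal hF) mulr0.
Qed.

Lemma delta_bd i (j : 'I_(frank F i)) : delta_mx 0 j *m bd i = row j (bd i).
Proof. by rewrite rowE. Qed.

Lemma bd_row_neq0 i (j : 'I_(frank F i)) : exists k, bd i j k != 0.
Proof.
apply/existsP; apply: contraT; rewrite negb_exists => /forallP b0.
have : (delta_mx 0 j : 'rV_(frank F i)) *m bd i = 0.
  by rewrite delta_bd; apply/rowP => k; rewrite !mxE; apply/eqP/negPn/b0.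
move=> /(@ker_minimal _ _ j); rewrite mxE !eqxx /= mcoeff1 eqxx => /eqP.
by rewrite oner_eq0.
Qed.

Lemma I_shift0 (j : 'I_(frank F 0)) : I 'X_[shift j].
Proof.
have [k bN0] := bd_row_neq0 j.
have [] := mono_poly (@bd_graded 0 j k) bN0.
rewrite /= subm0 => _ bE; set c := _@__ in bE.
have c0 : c != 0.
  by apply: contraNneq bN0 => c0; rewrite bE c0 scale0r.
apply/(augm_image hF); exists ((c^-1)%:MP *: delta_mx 0 j).
rewrite -scalemxAl (delta_bd j) !mxE -mul_mpolyC (ord1 k) /= in bE *.
by rewrite bE mulrA -mpolyCM mulVf // mul1r.
Qed.

(** The degree of a shift exceeds that of some shift of the preceding level
    dividing it. *)
Lemma shift_step i (j : 'I_(frank F i.+1)) :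
  exists2 k : 'I_(frank F i), (shift k <= shift j)%MM &
    (mdeg (shift k) < mdeg (shift j))%N.
Proof.
have [k bN0] := bd_row_neq0 j; exists k.
  by have [] := mono_poly (@bd_graded i.+1 j k) bN0.
have mE := bd_graded (mlead_supp bN0).
rewrite -mE mdegD /= -[ltnLHS]add0n ltn_add2r lt0n mdeg_eq0.
apply: contraNneq bN0 => m0; have := diff_minimal hF j k.
rewrite -m0 => /eqP; by rewrite -/(mleadc _) mleadc_eq0.
Qed.

Lemma shift_ge i (j : 'I_(frank F i)) : exists2 j0 : 'I_(frank F 0),
  (shift j0 <= shift j)%MM & (mdeg (shift j0) + i <= mdeg (shift j))%N.
Proof.
elim: i j => [|i IH] j; first by exists j; rewrite ?lepm_refl ?addn0.
have [k kj dk] := shift_step j; have [j0 j0k dj0] := IH k.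
exists j0; first exact: lepm_trans kj.
by rewrite addnS; apply: leq_ltn_trans dk.
Qed.

(** If [z = w *m bd i], then the [j]-th basis vector minus ['X_v *: w] would be a
    kernel vector with constant term 1. *)
Lemma row_bd_not_multiple i (j : 'I_(frank F i)) v (z : 'rV_(prank i)) :
  cycle z -> row j (bd i) <> 'X_v *: z.
Proof.
move=> /cycleP[w wE] zE.
have /(@ker_minimal _ _ j) : (delta_mx 0 j - 'X_v *: w) *m bd i = 0.
  by rewrite mulmxBl -scalemxAl -wE -zE delta_bd subrr.
rewrite !mxE !eqxx mcoeffB mcoeff1 eqxx mulrC mcoeffMXE lep1mP mnm0E /= subr0.
by move=> /eqP; rewrite oner_eq0.
Qed.

Lemma mpoly_divX (f : {mpoly K[n]}) v :
  (forall m, m \in msupp f -> (0 < m v)%N) -> exists g, f = 'X_v * g.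
Proof.
move=> fv; exists (\sum_(m <- msupp f) f@_m *: 'X_[(m - U_(v))%MM]).
rewrite mulr_sumr {1}[f]mpolyE; apply: eq_big_seq => m mf.
by rewrite -scalerAr -mpolyXD addmC submK // lep1mP -lt0n fv.
Qed.

(** If [I] allows division by [x_v] as long as the exponent of [x_v] exceeds [c],
    then no shift has a larger exponent of [x_v] than [c]. *)
Lemma shift_cap (v : 'I_n) (c : nat) :
  (forall m : 'X_{1..n}, (c < m v)%N -> I 'X_[m] -> I 'X_[(m - U_(v))%MM]) ->
  forall i (j : 'I_(frank F i)), (shift j v <= c)%N.
Proof.
move=> Iv; elim=> [|i IH] j; rewrite leqNgt; apply/negP => cj.
  have [k bN0] := bd_row_neq0 j; have [] := mono_poly (@bd_graded 0 j k) bN0.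
  rewrite /= subm0 => _ bE; set b := _@__ in bE.
  apply: (@row_bd_not_multiple 0 j v (b *: 'X_[(shift j - U_(v))])%:M).
    have /(augm_image hF)[w wE] := Iv _ cj (I_shift0 j).
    apply/(augm_image hF); exists (b%:MP *: w).
    by rewrite -scalemxAl !mxE /= mulr1n -mul_mpolyC wE mxE.
  apply/rowP => l; rewrite !mxE (ord1 l) (ord1 k) /= in bE *.
  rewrite mulr1n bE -scalerAr -mpolyXD addmC submK // lep1mP -lt0n.
  exact: leq_ltn_trans (leq0n c) cj.
have /fin_all_exists[z zE] k : exists g, bd i.+1 j k = 'X_v * g.
  apply: mpoly_divX => m /bd_graded /= mE.
  by have := IH k; have := cj; rewrite -mE mnmDE; lia.
have rowE' : row j (bd i.+1) = 'X_v *: \row_k z k.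
  by apply/rowP => k; rewrite !mxE zE.
refine (row_bd_not_multiple _ rowE').
have : (row j (bd i.+1)) *m bd i = 0.
  by apply/(@cycleP i.+1); exists (delta_mx 0 j); exact/esym/delta_bd.
rewrite rowE' -scalemxAl /=; move: (_ *m _) => A /rowP z0; apply/rowP => k.
have /eqP := z0 k; rewrite !mxE mulf_eq0 => /orP[/eqP X0|/eqP //].
have /(congr1 (mcoeff U_(v))) := X0.
by rewrite mcoeffX eqxx mcoeff0 => /eqP; rewrite oner_eq0.
Qed.

(** Homogeneous cycles have homogeneous preimages: keep the part of the right
    multidegree of an arbitrary preimage. *)
Lemma cycle_lift i b (z : 'rV_(prank i)) :
  cycle z -> homogeneous (@pshift i) b z ->
  exists2 v : 'rV_(frank F i), v *m bd i = z & homogeneous (@shift K n F i) b v.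
Proof.
move=> /cycleP[w zE] hz.
pose v : 'rV[{mpoly K[n]}]_(frank F i) := \row_j
  if (shift j <= b)%MM then (w 0 j)@_(b - shift j)%MM *: 'X_[(b - shift j)%MM]
  else 0.
have vE j m : (v 0 j)@_m = if (m + shift j)%MM == b then (w 0 j)@_m else 0.
  rewrite mxE; case: ifP => [jb|jNb].
    rewrite mcoeffZ mcoeffX; case: (_ =P m) => [<-|ne].
      by rewrite mulr1 submK // eqxx.
    by rewrite mulr0; case: eqP => // mb; case: ne; rewrite -mb addmK.
  by rewrite mcoeff0; case: eqP => // mb; rewrite -mb lem_addl in jNb.
exists v; last first.
  by move=> j m; rewrite mcoeff_msupp vE; case: (_ =P b); rewrite ?eqxx.
rewrite zE; apply/rowP => k; apply/mpolyP => m.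
have [mb|mNb] := eqVneq (m + pshift k)%MM b; last first.
  have : m \notin msupp (z 0 k) by apply: contraNN mNb => /hz ->.
  rewrite zE => /memN_msupp_eq0 ->; rewrite mxE raddf_sum big1 //= => j _.
  have [->|bN0] := eqVneq (bd i j k) 0; first by rewrite mulr0 mcoeff0.
  have [kj ->] := mono_poly (@bd_graded i j k) bN0.
  rewrite -scalerAr mcoeffZ mcoeffMXE vE; case: ifP => em; rewrite ?mulr0 //.
  case: eqP => [E|]; last by rewrite mulr0.
  case/eqP: mNb; rewrite -E -{1}(submK em) -addmA submK //.
rewrite !mxE !raddf_sum /=; apply: eq_bigr => j _.
have [->|bN0] := eqVneq (bd i j k) 0; first by rewrite !mulr0.
have [kj ->] := mono_poly (@bd_graded i j k) bN0.
rewrite -!scalerAr !mcoeffZ !mcoeffMXE vE; case: ifP => em //.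
have -> : (m - (shift j - pshift k) + shift j)%MM = b.
  by rewrite -[X in (_ + X)%MM](submK kj) addmA submK.
by rewrite eqxx.
Qed.

(** The degree bound says that the shifts of level [i] have degree at least
    [mdeg w + i + 1], which is the degree of [w] times [i + 1] variables. *)
Section Nonvanishing.
Variables (w : 'X_{1..n}) (G : {set 'I_n}).
Hypothesis I_w : forall t, t \in G -> I 'X_[(w + U_(t))%MM].
Hypothesis shift_deg :
  forall i (j : 'I_(frank F i)), (mdeg w + i.+1 <= mdeg (shift j))%N.

(** Lists of distinct elements of [G]. *)
Definition uniq_in (s : seq 'I_n) : bool := uniq s && all (mem G) s.

Lemma uniq_in_sub s s' : subseq s' s -> uniq_in s -> uniq_in s'.
Proof.
move=> ss /andP[us aG]; rewrite /uniq_in (subseq_uniq ss us) /=.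
by apply/allP => x /(mem_subseq ss); move/allP: aG; apply.
Qed.

(** The Koszul boundaries of [psi], on lists of length [i + 1], are non-zero
    homogeneous cycles at level [i]. *)
Definition koszul_lifts i (psi : seq 'I_n -> 'rV[{mpoly K[n]}]_(prank i)) :=
  forall s, uniq_in s -> size s = i.+1 ->
    [/\ cycle (koszul s psi),
        homogeneous (@pshift i) (w + mnmseq s) (koszul s psi)
      & koszul s psi != 0].

Lemma koszul_lifts0 : @koszul_lifts 0 (fun=> 'X_[w]%:M).
Proof.
move=> [//|t [|//]] /andP[_ /andP[tG _]] _ /=; rewrite subr0.
have E : ('X_t *: 'X_[w]%:M : 'M[{mpoly K[n]}]_1) = 'X_[(w + U_(t))%MM]%:M.
  by rewrite scale_scalar_mx -mpolyXD addmC.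
rewrite E; split.
- by rewrite mxE mulr1n; apply: I_w.
- move=> j m; rewrite mxE (ord1 j) mulr1n msuppX inE => /eqP ->.
  by rewrite /mnmseq big_seq1 addm0.
apply/eqP => /matrixP/(_ 0 0); rewrite !mxE mulr1n.
move=> /(congr1 (mcoeff (w + U_(t)))) /eqP.
by rewrite mcoeffX eqxx mcoeff0 oner_eq0.
Qed.

(** In the lowest possible degree, a homogeneous vector only involves basis
    elements of its own multidegree. *)
Lemma homogeneous_min i (v : 'rV[{mpoly K[n]}]_(frank F i)) s j : size s = i.+1 ->
  homogeneous (@shift K n F i) (w + mnmseq s) v -> v 0 j != 0 ->
  shift j = (w + mnmseq s)%MM.
Proof.
move=> szs hv /mlead_supp /hv E.
have := shift_deg j; rewrite -szs -(mdeg_mnmseq s) -mdegD -E mdegD.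
rewrite -{2}[mdeg (shift j)]add0n leq_add2r leqn0 mdeg_eq0 => /eqP m0.
by rewrite m0 add0m.
Qed.

(** The induction step: [phi s] is a homogeneous preimage of [koszul s psi].  Its
    Koszul boundary is a cycle because the square of [koszul] vanishes.  It is
    non-zero: a basis element that occurs in [phi s] has multidegree
    [w + mnmseq s], so it occurs in no other term of the boundary at [t :: s]. *)
Lemma koszul_liftsS i psi : @koszul_lifts i psi ->
  exists phi : seq 'I_n -> 'rV[{mpoly K[n]}]_(frank F i),
    (forall s, uniq_in s -> size s = i.+1 ->
       homogeneous (@shift K n F i) (w + mnmseq s) (phi s) /\ phi s != 0) /\
    @koszul_lifts i.+1 phi.
Proof.
move=> hpsi.
pose lift s (v : 'rV[{mpoly K[n]}]_(frank F i)) :=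
  v *m bd i = koszul s psi /\ homogeneous (@shift K n F i) (w + mnmseq s) v.
pose phi s := epsilon (inhabits 0) (lift s).
have phiP s : uniq_in s -> size s = i.+1 -> phi s *m bd i = koszul s psi /\
    homogeneous (@shift K n F i) (w + mnmseq s) (phi s).
  move=> gs szs; have [cs hs _] := hpsi s gs szs.
  have [v vE hv] := cycle_lift cs hs.
  by apply: (epsilon_spec (inhabits 0) (lift s)); exists v.
have phiN0 s : uniq_in s -> size s = i.+1 -> phi s != 0.
  move=> gs szs; have [_ _] := hpsi s gs szs.
  by apply: contraNneq => p0; rewrite -(phiP s gs szs).1 p0 mul0mx.
exists phi; split.
  by move=> s gs szs; split; [have [] := phiP s gs szs | exact: phiN0].
move=> s gs szs.
have sub s' : subseq s' s -> (size s').+1 = size s -> uniq_in s' /\ size s' = i.+1.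
  by move=> ss sz; split; [exact: uniq_in_sub gs|move: sz; rewrite szs => -[]].
split.
- rewrite /= -koszul_mulmx.
  rewrite (@koszul_ext _ _ _ _ _ (fun x => koszul x psi)) ?koszul_koszul //.
  by move=> s' ss sz; have [gs' szs'] := sub s' ss sz; case: (phiP s' gs' szs').
- apply: homogeneous_koszul => s' ss sz; have [gs' szs'] := sub s' ss sz.
  by case: (phiP s' gs' szs').
case: s gs szs sub => [//|t s] gs [szs] sub.
have [gs' _] := sub s (subseq_cons _ _) erefl.
have /rV0Pn[j pj] := phiN0 s gs' szs.
apply/eqP => /rowP/(_ j); rewrite /= [LHS]mxE [RHS]mxE [X in X + _]mxE.
rewrite [X in _ + X]mxE koszul_entry0 ?oppr0 ?addr0; last first.
  move=> s' ss sz.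
  have [gts szts] : uniq_in (t :: s') /\ size (t :: s') = i.+1.
    by apply: sub; rewrite /= ?eqxx ?sz.
  apply/eqP; apply: contraT => ptj.
  have E1 := homogeneous_min szs (phiP s gs' szs).2 pj.
  have E2 := homogeneous_min szts (phiP _ gts szts).2 ptj.
  have tNs : t \notin s by move: gs => /andP[/= /andP[]].
  have := congr1 (fun m : 'X_{1..n} => m t) (etrans (esym E1) E2).
  rewrite mnmseq_cons !mnmDE mnm1E eqxx (mnmseq_notin tNs); lia.
move=> /eqP; rewrite mulf_eq0 (negbTE pj) orbF => /eqP.
move=> /(congr1 (mcoeff U_(t))) /eqP.
by rewrite mcoeffX eqxx mcoeff0 oner_eq0.
Qed.

(** The lift at level [k] is non-zero on [s], hence involves a basis element of
    this multidegree. *)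
Lemma shift_exists k s : uniq_in s -> size s = k.+1 ->
  exists j : 'I_(frank F k), shift j = (w + mnmseq s)%MM.
Proof.
move=> gs szs; have [psi hpsi] : exists psi, @koszul_lifts k psi.
  elim: k {szs} => [|k [psi /koszul_liftsS[phi [_ hphi]]]]; last by exists phi.
  by eexists; apply: koszul_lifts0.
have [phi [/(_ s gs szs)[hp /rV0Pn[j pj]] _]] := koszul_liftsS hpsi.
by exists j; apply: homogeneous_min pj.
Qed.

End Nonvanishing.

End Resolution.

(** * The homological shift ideals and their multiplicities *)

(** [C] is a cover when its complement is a face, so the largest faces are the
    complements of the smallest covers. *)
Lemma multiplicity_covers (K : fieldType) (n : nat) (J : {mpoly K[n]} -> Prop)
    (Q : pred {set 'I_n}) (h : nat) :
  (forall f, J f <-> forall m, m \in msupp f -> Q (msupport m)) ->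
  (forall C : {set 'I_n}, ~~ Q (~: C) -> (h <= #|C|)%N) ->
  (0 < #|[set C : {set 'I_n} | ~~ Q (~: C) & #|C| == h]|)%N ->
  multiplicity J = #|[set C : {set 'I_n} | ~~ Q (~: C) & #|C| == h]|%:R.
Proof.
move=> JQ hmin ex; have cC (A : {set 'I_n}) : (#|A| + #|~: A| = n)%N.
  by rewrite cardsC card_ord.
have [C0 /setIdP[QC0 /eqP cC0]] : exists C0, C0 \in [set C | ~~ Q (~: C) & #|C| == h].
  by apply/set0Pn; rewrite -card_gt0.
rewrite (multiplicity_faces JQ (D := (n - h)%N)); first last.
- by exists (~: C0) => //; have := cC C0; rewrite cC0; lia.
- move=> s; rewrite -{1}(setCK s) => /hmin; have := cC s; lia.
congr (_%:R); rewrite -(card_imset _ (@setC_inj 'I_n)).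
congr #|pred_of_set _|; apply/setP => C.
rewrite -{1}[C]setCK (mem_imset _ _ (@setC_inj _)) !inE; congr (_ && _).
have := cC C; have := cC C0; rewrite cC0.
by move=> *; apply/eqP/eqP; lia.
Qed.

(** One plus the largest index of [A], or 0 if [A] is empty. *)
Definition top n (A : {set 'I_n}) : nat := \max_(i in A) i.+1.

Section Top.
Variable n : nat.
Implicit Types (A B C : {set 'I_n}) (t : nat).

Lemma top_le A : (top A <= n)%N.
Proof. by apply/bigmax_leqP => i _. Qed.

Lemma in_top A i : i \in A -> (i < top A)%N.
Proof. exact: (@leq_bigmax_cond _ (mem A) (fun i : 'I_n => i.+1)). Qed.

Lemma cnt_full A t : (forall i, i \in A -> (i < t)%N) -> cnt A t = #|A|.
Proof.
move=> At; congr #|pred_of_set _|; apply/setP => i; rewrite !inE.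
by case: (boolP (i \in A)) => // /At ->.
Qed.

Lemma cnt_top A t : (top A <= t)%N -> cnt A t = #|A|.
Proof. by move=> At; apply: cnt_full => i /in_top /leq_trans; apply. Qed.

Lemma cnt_lt_top A t : (t < top A)%N -> (cnt A t < #|A|)%N.
Proof.
move=> tA; apply: proper_card; apply/properP; split.
  by apply/subsetP => i; rewrite inE => /andP[].
have [i iA it] : exists2 i, i \in A & (t <= i)%N.
  apply/exists_inP; apply: contraLR tA; rewrite negb_exists_in -leqNgt.
  move=> /forall_inP At; apply/bigmax_leqP => i /At; by rewrite -ltnNge.
by exists i; rewrite // inE iA /= -leqNgt.
Qed.

Lemma cnt0 A : cnt A 0 = 0%N.
Proof. by apply/eqP; rewrite cards_eq0; apply/eqP/setP => i; rewrite !inE andbF. Qed.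

Lemma cntS_le A t : (cnt A t.+1 <= (cnt A t).+1)%N.
Proof.
have [tn|nt] := ltnP t n; last first.
  by rewrite !cnt_full ?leqnSn // => i _; have := ltn_ord i; lia.
have [iA|iNA] := boolP (Ordinal tn \in A); first by rewrite (cnt_id iA).
by rewrite (cnt_notin iNA) leqnSn.
Qed.

Lemma cnt_ivt A r : (r <= #|A|)%N -> exists t, cnt A t = r.
Proof.
move=> rA; have ex : exists t, (r <= cnt A t)%N by exists (top A); rewrite cnt_top.
case: (ex_minnP ex) => t rt tmin; exists t; apply/eqP; rewrite eqn_leq rt andbT.
case: t rt tmin => [|t] rt tmin; first by rewrite cnt0.
apply: leq_trans (cntS_le A t) _; rewrite ltnNge; apply/negP => /tmin.
by rewrite ltnn.
Qed.

Lemma cnt_setT t : (t <= n)%N -> cnt [set: 'I_n] t = t.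
Proof.
elim: t => [|t IH] tn; first by rewrite cnt0.
by rewrite (@cnt_id _ _ (Ordinal tn)) ?inE // IH // ltnW.
Qed.

Lemma cntC C t : (t <= n)%N -> (cnt C t + cnt (~: C) t = t)%N.
Proof.
move=> tn; have := cardsID C [set i in [set: 'I_n] | (i < t)%N].
rewrite -/(cnt setT t) cnt_setT // => E; rewrite -[RHS]E.
by congr (_ + _)%N; apply: eq_card => i; rewrite !inE // andbC.
Qed.

Lemma cnt_le A t : (cnt A t <= t)%N.
Proof.
have [tn|/ltnW nt] := leqP t n; first by rewrite -[leqRHS](cntC A tn) leq_addr.
apply: leq_trans nt; apply: leq_trans (cnt_le_card _ _) _.
by rewrite -[leqRHS]card_ord max_card.
Qed.

Lemma cnt_eq_card C t : (cnt C t == #|C|) = (C \subset [set i : 'I_n | (i < t)%N]).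
Proof.
apply/eqP/subsetP => [E i iC|Ct]; last by apply: cnt_full => i /Ct; rewrite inE.
have /eqP E' : [set i in C | (i < t)%N] == C.
  rewrite eqEcard -/(cnt C t) E leqnn andbT.
  by apply/subsetP => l; rewrite inE => /andP[].
by move: iC; rewrite -E' !inE => /andP[].
Qed.

End Top.

Section HomologicalShifts.
Variables (K : fieldType) (n : nat) (u : 'X_{1..n}).
Hypothesis hu : squarefree u.
Variable F : free_complex K n.
Hypothesis hF : minimal_free_resolution F (@B1 K n u).

Let a := msupport u.
Let M := top a.

(** The condition on a support [s] for the monomial to lie in [HS_k]: [s] contains
    at least [#|a| + k] indices below [M], and for non-empty [a] its first
    [#|a| - 1] indices are at most the corresponding ones of [a]. *)
Definition HSsupp k (s : {set 'I_n}) : bool :=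
  (#|a| + k <= cnt s M)%N &&
  [forall t : 'I_n, (t < M)%N ==> (cnt a t <= cnt s t)%N].

Lemma HSsuppP k s : reflect
  ((#|a| + k <= cnt s M)%N /\ forall t, (t < M)%N -> (cnt a t <= cnt s t)%N)
  (HSsupp k s).
Proof.
apply: (iffP andP) => -[cM ct]; split => //.
  move=> t tM; have tn : (t < n)%N := leq_trans tM (top_le a).
  by have /forallP/(_ (Ordinal tn))/implyP := ct; apply.
by apply/forallP => t; apply/implyP => /ct.
Qed.

Lemma B1X m : B1 u ('X_[m] : {mpoly K[n]}) <-> dominates (msupport m) a.
Proof.
rewrite (B1E _ hu); split=> [|dm m']; last by rewrite msuppX inE => /eqP ->.
by apply; rewrite msuppX inE.
Qed.

(** The shifts are squarefree and involve only variables of index below [M]. *)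
Lemma B1_shift_cap k (j : 'I_(frank F k)) v : (shift j v <= (v < M)%N)%N.
Proof.
apply: (shift_cap hF) => m; case: (ltnP v M) => vM mv /B1X dm; apply/B1X => t.
  rewrite (_ : msupport _ = msupport m); first exact: dm.
  apply/setP => i; rewrite !inE mnmBE mnm1E.
  by case: eqP => [<-|_]; rewrite ?subn0 //; lia.
have sub : msupport m :\ v \subset msupport (m - U_(v))%MM.
  apply/subsetP => i; rewrite !inE mnmBE mnm1E eq_sym => /andP[/negbTE -> mi].
  by rewrite subn0.
have vm : v \in msupport m by rewrite in_msupport.
have cle t' : (t' <= M)%N -> cnt (msupport m :\ v) t' = cnt (msupport m) t'.
  by move=> tM; rewrite (cntD1 t' vm) ltnNge (leq_trans tM vM).
have [tM|/ltnW Mt] := leqP t M.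
  by apply: leq_trans (cntS t sub); rewrite cle.
rewrite (cnt_top Mt) -(cnt_top (leqnn M)); apply: leq_trans (dm M) _.
by rewrite -cle //; apply: leq_trans (cntS M sub) (cnt_mono _ Mt).
Qed.

Lemma B1_shift_deg k (j : 'I_(frank F k)) : (#|a| + k <= mdeg (shift j))%N.
Proof.
have [j0 _ dj0] := shift_ge hF j; apply: leq_trans dj0; rewrite leq_add2r.
have /B1X/(_ M) := I_shift0 hF j0; rewrite cnt_top // => /leq_trans; apply.
apply: leq_trans (card_msupport_le _); exact: cnt_le_card.
Qed.

Lemma HSsupp_shift k (j : 'I_(frank F k)) : HSsupp k (msupport (shift j)).
Proof.
have sj : squarefree (shift j).
  by move=> i; apply: leq_trans (B1_shift_cap j i) (leq_b1 _).
apply/HSsuppP; split.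
  rewrite cnt_full.
    by rewrite -(mdeg_mnmset (msupport _)) -squarefreeE // B1_shift_deg.
  move=> i; rewrite in_msupport => ij; have := leq_trans ij (B1_shift_cap j i).
  by rewrite lt0b.
move=> t _; have [j0 j0j _] := shift_ge hF j.
have /B1X/(_ t) := I_shift0 hF j0; move/leq_trans; apply; apply: cntS.
apply/subsetP => i; rewrite !in_msupport => /leq_trans; apply.
exact: (mnm_lepP j0j).
Qed.

(** Every monomial of the ideal is a multiple of a shift of level 0. *)
Lemma shift0_below m : B1 u ('X_[m] : {mpoly K[n]}) ->
  exists j : 'I_(frank F 0), (shift j <= m)%MM.
Proof.
move=> /(augm_image hF)[v]; rewrite mxE => E.
have : m \in msupp ('X_[m] : {mpoly K[n]}) by rewrite msuppX inE.
rewrite E => /msupp_sum_le /flatten_mapP[j _] /msuppM_le /allpairsP.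
case=> -[x y] /= [_ /(augm_graded hF) -> ->].
by exists j; rewrite lem_addl.
Qed.

Lemma mnmseqE (s : seq 'I_n) i : uniq s -> mnmseq s i = (i \in s).
Proof.
elim: s => [|t s IH] /=; first by rewrite /mnmseq big_nil mnm0E.
move=> /andP[ts us]; rewrite mnmseq_cons mnmDE mnm1E IH // inE eq_sym.
by case: eqP => // ->; rewrite (negbTE ts).
Qed.

(** The Koszul construction applies to the set [W] of the first [#|a| - 1] indices
    of [s] and to [k + 1] of its remaining indices below [M]. *)
Lemma shift_below k m : HSsupp k (msupport m) ->
  exists j : 'I_(frank F k), (shift j <= m)%MM.
Proof.
move=> /HSsuppP[]; set s := msupport m => cM ct.
case d0 : #|a| => [|d]; rewrite d0 in cM.
  have M0 : M = 0%N.
    by rewrite /M /top (cards0_eq d0) big_set0.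
  have k0 : k = 0%N by move: cM; rewrite M0 cnt0; lia.
  rewrite k0; apply/shift0_below/B1X => t.
  by apply: leq_trans (cnt_le_card _ _) _; rewrite d0.
(* [t0] separates the first [d] elements of [B] from the others. *)
pose B := [set i in s | (i < M)%N].
have cB : #|B| = cnt s M by [].
have cBs t : (t <= M)%N -> cnt B t = cnt s t.
  move=> tM; congr #|pred_of_set _|; apply/setP => i; rewrite !inE.
  by case: (ltnP i t) => it; rewrite ?andbF // (leq_trans it tM) !andbT.
have [t0 ct0] : exists t, cnt B t = d by apply: cnt_ivt; rewrite cB; lia.
pose W := [set i in B | (i < t0)%N].
have cW : #|W| = d by [].
have cWt t : (t < M)%N -> (cnt a t <= cnt W t)%N.
  move=> tM; have [tt0|/ltnW t0t] := leqP t t0.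
    apply: leq_trans (ct t tM) _; rewrite -cBs; last exact: ltnW.
    apply: subset_leq_card; apply/subsetP => i; rewrite !inE.
    by move=> /andP[-> it]; rewrite it (leq_trans it tt0).
  rewrite [leqRHS]cnt_full ?cW; last first.
    by move=> i; rewrite !inE => /andP[_ /leq_trans]; apply.
  by rewrite -ltnS -d0 cnt_lt_top.
pose G := B :\: W.
have WB : W \subset B by apply/subsetP => i; rewrite inE => /andP[].
have cG : (k.+1 <= #|G|)%N.
  by have := cardsID W B; rewrite (setIidPr WB) cW cB -/G; lia.
have gs : uniq_in G (take k.+1 (enum G)).
  rewrite /uniq_in take_uniq ?enum_uniq //=; apply/allP => i /mem_take.
  by rewrite mem_enum.
have sz : size (take k.+1 (enum G)) = k.+1.
  by rewrite size_takel // -cardE.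
have IW t : t \in G -> B1 u ('X_[(mnmset W + U_(t))%MM] : {mpoly K[n]}).
  rewrite inE => /andP[tW tB]; apply/B1X => t1.
  have -> : msupport (mnmset W + U_(t))%MM = t |: W.
    apply/setP => i; rewrite in_msupport mnmDE mnmsetE mnm1E in_setU1 eq_sym.
    by case: (_ \in W); case: (_ == _).
  rewrite cntU1 //; have [t1M|Mt1] := ltnP t1 M.
    by apply: leq_trans (cWt _ t1M) (leq_addl _ _).
  have tM : (t < M)%N by move: tB; rewrite inE => /andP[].
  rewrite (leq_trans tM Mt1) cnt_top // d0 [cnt W t1]cnt_full ?cW //.
  by move=> i /(subsetP WB); rewrite inE => /andP[_ /leq_trans]; apply.
have deg i (j : 'I_(frank F i)) : (mdeg (mnmset W) + i.+1 <= mdeg (shift j))%N.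
  by rewrite mdeg_mnmset cW addnS -addSn -d0 B1_shift_deg.
have [j jE] := shift_exists hF IW deg gs sz.
exists j; rewrite jE; apply/mnm_lepP => i.
rewrite mnmDE mnmsetE mnmseqE; last by case/andP: gs.
have inB : i \in B -> (0 < m i)%N by rewrite -in_msupport inE => /andP[].
have [iW|iW] := boolP (i \in W).
  rewrite (_ : i \in _ = false); first by rewrite addn0 inB // (subsetP WB).
  apply/negP => iG; case/andP: gs => _ /allP/(_ i iG).
  by rewrite !inE; move: iW; rewrite !inE => ->.
rewrite add0n; have [iG|//] := boolP (i \in take _ _).
case/andP: gs => _ /allP/(_ i iG) /=; rewrite inE => /andP[_]; exact: inB.
Qed.

Lemma HS_HSsupp k f : HS F k f <->
  forall m, m \in msupp f -> HSsupp k (msupport m).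
Proof.
rewrite /HS monomial_idealP; split=> fP m /fP; last first.
  by move=> /shift_below[j jm]; exists (shift j) => //; exists j.
move=> [_ [j ->] jm].
have sub : msupport (shift j) \subset msupport m.
  apply/subsetP => i; rewrite !in_msupport => /leq_trans; apply.
  exact: (mnm_lepP jm).
have /HSsuppP[cM ct] := HSsupp_shift j; apply/HSsuppP; split.
  exact: leq_trans cM (cntS _ sub).
by move=> t /ct /leq_trans; apply; apply: cntS.
Qed.

(** The least number of the first [M] variables that must be removed for fewer
    than [#|a| + k] of them to be left. *)
Definition coverdim k : nat := (M.+1 - (#|a| + k))%N.

Lemma HSsuppC k C : ~~ HSsupp k (~: C) <->
  (coverdim k <= cnt C M)%N \/
  exists2 t, (t < M)%N & (t < cnt a t + cnt C t)%N.
Proof.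
have Mn : (M <= n)%N := top_le a.
have cCM := cntC C Mn.
split=> [|[hk|[t tM tC]]].
- have [hk|hk] := leqP (coverdim k) (cnt C M); [by left|move=> NF; right].
  have [t /andP[tM tC]] : exists t : 'I_n, (t < M)%N && (cnt (~: C) t < cnt a t)%N.
    apply/existsP; apply: contraNT NF; rewrite negb_exists => /forallP NF.
    apply/HSsuppP; split; first by rewrite /coverdim in hk; lia.
    move=> t tM; have := NF (Ordinal (leq_trans tM Mn)).
    by rewrite /= tM /= -leqNgt.
  by exists t => //; have := cntC C (ltnW (ltn_ord t)); lia.
- by apply/negP => /HSsuppP[+ _]; rewrite /coverdim in hk; lia.
apply/negP => /HSsuppP[_ /(_ t tM)].
by have := cntC C (ltnW (leq_trans tM Mn)); lia.
Qed.

(** The case of a non-empty support, [i0] being its least index; the one-based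
    first index is [i0.+1]. *)
Section Positive.
Variable i0 : 'I_n.
Hypotheses (i0a : i0 \in a) (i0min : forall i, i \in a -> (i0 <= i)%N).

(** [C] meets every support in [HS_k] because of the condition at some [t < M],
    which does not involve [k]. *)
Definition early (C : {set 'I_n}) : bool :=
  [exists t : 'I_n, (t < M)%N && (t < cnt a t + cnt C t)%N].

Lemma earlyP C : reflect (exists2 t, (t < M)%N & (t < cnt a t + cnt C t)%N) (early C).
Proof.
apply: (iffP existsP) => [[t /andP[tM tC]]|[t tM tC]]; first by exists t.
by exists (Ordinal (leq_trans tM (top_le a))); rewrite /= tM.
Qed.

Lemma i0_le i : (0 < u i)%N -> (i0 <= i)%N.
Proof. by rewrite -in_msupport; apply: i0min. Qed.

Lemma cnt_a_le t : (cnt a t <= t - i0)%N.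
Proof.
have [tn|/ltnW nt] := leqP t n; last first.
  have := cntC a (leqnn n).
  have H : (cnt [set i : 'I_n | (i < i0)%N] n <= cnt (~: a) n)%N.
    apply: cntS; apply/subsetP => i; rewrite !inE => ii0; apply/negP => /i0_le.
    by rewrite leqNgt ii0.
  have E : cnt [set i : 'I_n | (i < i0)%N] n = i0.
    rewrite -[RHS](cnt_setT (ltnW (ltn_ord i0))).
    by congr #|pred_of_set _|; apply/setP => i; rewrite !inE ltn_ord andbT.
  have := cnt_full (A := a) (t := t) (fun i _ => leq_trans (ltn_ord i) nt).
  have := cnt_full (A := a) (t := n) (fun i _ => ltn_ord i).
  lia.
have H : (cnt (~: a) (minn t i0) <= cnt (~: a) t)%N by rewrite cnt_mono ?geq_minl.
have := cntC a tn; have mn : (minn t i0 <= n)%N by rewrite (leq_trans (geq_minl _ _)).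
have := cntC a mn.
have -> : cnt a (minn t i0) = 0%N.
  apply/eqP; rewrite cards_eq0; apply/eqP/setP => i; rewrite !inE.
  apply/negP => /andP[/i0_le]; lia.
lia.
Qed.

(** Since [t - cnt a t] is at least [i0] for [t > i0], a failure at [t] requires
    [i0 + 1] elements of [C] below [t]. *)
Lemma early_cnt C : early C -> (i0 < cnt C M)%N.
Proof.
move=> /earlyP[t tM tC]; have := cnt_a_le t; have := cnt_le C t.
by have := cnt_mono C (ltnW tM); lia.
Qed.

(** A set of size [h] with [h] elements below [M] is a subset of the first [M]
    variables. *)
Lemma card_lowsets h :
  #|[set C : {set 'I_n} | (h <= cnt C M)%N & #|C| == h]| = 'C(M, h).
Proof.
have cM : #|[set i : 'I_n | (i < M)%N]| = M.
  rewrite -[RHS](cnt_setT (top_le a)).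
  by congr #|pred_of_set _|; apply/setP => i; rewrite !inE.
rewrite -[in RHS]cM -cards_draws; congr #|pred_of_set _|; apply/setP => C.
rewrite !inE.
case: (#|C| =P h) => [<-|]; rewrite ?andbF // !andbT -cnt_eq_card eqn_leq.
by rewrite cnt_le_card.
Qed.

Lemma a_gt0 : (0 < #|a|)%N.
Proof. by rewrite card_gt0; apply/set0Pn; exists i0. Qed.

Lemma multiplicity_HS_small k : (coverdim k <= i0.+1)%N ->
  multiplicity (HS F k) = 'C(M, coverdim k)%:R.
Proof.
move=> hk; have E C : ~~ HSsupp k (~: C) = (coverdim k <= cnt C M)%N.
  apply/idP/idP => [/HSsuppC[//|/earlyP/early_cnt]|hC]; last by apply/HSsuppC; left.
  exact: leq_trans.
have cE : #|[set C : {set 'I_n} | ~~ HSsupp k (~: C) & #|C| == coverdim k]|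
    = 'C(M, coverdim k).
  rewrite -card_lowsets; congr #|pred_of_set _|; apply/setP => C.
  by rewrite !inE E.
rewrite (multiplicity_covers (HS_HSsupp k) (h := coverdim k)) ?cE //.
  by move=> C; rewrite E => /leq_trans; apply; apply: cnt_le_card.
by rewrite bin_gt0 /coverdim; have := a_gt0; lia.
Qed.

(** The number of the smallest covers of [HS_k], as long as
    [i0.+1 < coverdim k]. *)
Definition earlycovers : nat :=
  #|[set C : {set 'I_n} | early C & #|C| == i0.+1]|.

Lemma earlycovers_le : (earlycovers <= 'C(M, i0.+1))%N.
Proof.
rewrite -card_lowsets; apply: subset_leq_card; apply/subsetP => C; rewrite !inE.
by move=> /andP[/early_cnt -> ->].
Qed.

Lemma multiplicity_HS_large k : (i0.+1 < coverdim k)%N ->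
  multiplicity (HS F k) = earlycovers%:R.
Proof.
move=> hk; have E (C : {set 'I_n}) : #|C| = i0.+1 -> ~~ HSsupp k (~: C) = early C.
  move=> cC; apply/idP/idP => [/HSsuppC[|/earlyP //]|/earlyP eC].
    by have := cnt_le_card C M; lia.
  by apply/HSsuppC; right.
have cE : #|[set C : {set 'I_n} | ~~ HSsupp k (~: C) & #|C| == i0.+1]|
    = earlycovers.
  congr #|pred_of_set _|; apply/setP => C; rewrite !inE.
  by case: (#|C| =P i0.+1) => [/E ->|]; rewrite ?andbF.
rewrite (multiplicity_covers (HS_HSsupp k) (h := i0.+1)) ?cE //.
  move=> C /HSsuppC[hC|/earlyP/early_cnt eC]; have := cnt_le_card C M; lia.
rewrite card_gt0; apply/set0Pn; exists [set i : 'I_n | (i < i0.+1)%N].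
(* The first [i0.+1] variables form a cover, by the condition at [i0.+1], which
   is below [M] as [i0.+1 < coverdim k]. *)
have cS : cnt [set i : 'I_n | (i < i0.+1)%N] i0.+1 = i0.+1.
  rewrite -[RHS](cnt_setT (ltn_ord i0)).
  by congr #|pred_of_set _|; apply/setP => i; rewrite !inE andbb.
rewrite inE; apply/andP; split; last first.
  by rewrite -{2}cS eq_sym cnt_eq_card.
apply/earlyP; exists i0.+1; last by rewrite cS (cnt_id i0a); lia.
by have := a_gt0; rewrite /coverdim in hk; lia.
Qed.

End Positive.

(** For [u = 1] the ideal is the whole ring, with [HS_0] the whole ring and
    [HS_k = 0] for positive [k]. *)
Lemma multiplicity_HS_unit k : a = set0 ->
  multiplicity (HS F k) = (k != 0%N)%:R.
Proof.
move=> a0; have M0 : M = 0%N by rewrite /M /top a0 big_set0.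
have E s : HSsupp k s = (k == 0%N).
  apply/HSsuppP/eqP => [[]|->]; rewrite M0 cnt0 a0 cards0; first by lia.
  by split.
case: eqP E => [_ E|k0 E].
  by rewrite (multiplicity_void (HS_HSsupp k)).
have cE : #|[set C : {set 'I_n} | ~~ HSsupp k (~: C) & #|C| == 0%N]| = 1%N.
  rewrite -(cards1 (set0 : {set 'I_n})); congr #|pred_of_set _|.
  by apply/setP => C; rewrite !inE E cards_eq0.
by rewrite (multiplicity_covers (HS_HSsupp k) (h := 0%N)) ?cE.
Qed.

End HomologicalShifts.

Lemma bin_up m k : (k.*2 < m)%N -> ('C(m, k) <= 'C(m, k.+1))%N.
Proof.
move=> km; rewrite -(leq_pmul2l (ltn0Sn k)) mul_bin_left leq_mul2r; lia.
Qed.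

Lemma bin_down m k : (m <= k.*2.+1)%N -> ('C(m, k.+1) <= 'C(m, k))%N.
Proof.
move=> km; rewrite -(leq_pmul2l (ltn0Sn k)) mul_bin_left leq_mul2r; lia.
Qed.

(** [M.+1 - (d + k)] decreases with [k]; the peak is where it passes below both
    [j] and half of [M]. *)
Lemma unimodal_bin (M d j c : nat) (f : nat -> rat) : (c <= 'C(M, j))%N ->
  (forall k, f k = (if (j < M.+1 - (d + k))%N then c
                    else 'C(M, M.+1 - (d + k)))%:R) ->
  unimodal f.
Proof.
move=> cM fE; exists (M.+1 - d - minn j M./2)%N.
have hS k : (M.+1 - (d + k.+1) = (M.+1 - (d + k)).-1)%N by lia.
split=> k kp; rewrite !fE ler_nat hS.
  have : (minn j M./2 < M.+1 - (d + k))%N by lia.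
  case: (M.+1 - (d + k))%N => // h hm /=.
  case: (ltnP j h.+1) => [jh|hj]; case: (ltnP j h) => hj'; try by lia.
    by rewrite (_ : h = j) //; lia.
  by apply: bin_down; lia.
have : (M.+1 - (d + k) <= minn j M./2)%N by lia.
case: (M.+1 - (d + k))%N => [|h] hm //=.
case: (ltnP j h.+1) => [jh|hj]; case: (ltnP j h) => hj'; try by lia.
by apply: bin_up; lia.
Qed.

Theorem proposition4p4 (K : fieldType) (n : nat) (u : 'X_{1..n})
    (hu : squarefree u)
    (F : free_complex K n) (hF : minimal_free_resolution F (@B1 K n u)) :
  unimodal (fun k : nat => multiplicity (HS F k)).
Proof.
have [a0|[i ia]] := set_0Vmem (msupport u).
  by exists 1%N; split=> k; rewrite !(multiplicity_HS_unit hu hF) // ler_nat; case: k.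
have [i0 i0a i0min] := @arg_minnP _ i (mem (msupport u)) val ia.
apply: (@unimodal_bin (top (msupport u)) #|msupport u| i0.+1 (earlycovers u i0)).
  exact: earlycovers_le.
move=> k; case: ltnP => hk; first exact: multiplicity_HS_large.
exact: (multiplicity_HS_small hu hF i0a i0min hk).
Qed.
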